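(* Let $A$ be a commutative ring, $E$ a non-zero $A$-module and $R=A\propto E$ the trivial ring extension of $A$ by $E$. The following two conditions are equivalent: (1) $R$ is $1$-semiregular; (2) $A$ and $E$ verify the following properties: (a) $A$ is $1$-semiregular; (b) $A_P$ is a field for each $P\in\mathrm{Supp}(E)$; (c) $E_P$ is a simple module for each $P\in\mathrm{Supp}(E)$; (d) $E$ is FP-injective and coherent (as an $A$-module).
   Context: All rings are commutative with identity and all modules are unitary. A ring $R$ is $1$-semiregular if every finitely presented $R$-module $M$ is $1$-periodic, i.e. there is an exact sequence $0\to M\to P\to M\to 0$ with $P$ projective. The trivial ring extension $A\propto E$ is the ring with underlying additive group $A\times E$ and multiplication $(a,e)(a',e')=(aa',ae'+a'e)$. $\mathrm{Supp}(E)$ is the set of prime ideals $P$ of $A$ with $E_P\neq 0$. An $A$-module $E$ is FP-injective if $\mathrm{Ext}^1_A(M,E)=0$ for every finitely presented $A$-module $M$. An $A$-module $E$ is coherent if each of its finitely generated submodules is finitely presented ($E$ itself is not required to be finitely generated). *)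

(* Defs.v *)
From HB Require Import structures.
From mathcomp Require Import all_boot all_algebra.
From mathcomp Require Import ring_quotient generic_quotient.
From mathcomp Require Import boolp ring.

Set Implicit Arguments.
Unset Strict Implicit.
Unset Printing Implicit Defensive.

Import GRing.Theory.
Local Open Scope ring_scope.
Local Open Scope quotient_scope.

Section Modules.
Variable R : pzRingType.

Definition onto (U V : Type) (f : U -> V) : Prop := forall y, exists x, f x = y.

Definition exact_at (U V W : lmodType R) (f : U -> V) (g : V -> W) : Prop :=
  forall y, g y = 0 <-> exists x, f x = y.

Definition short_exact (U V W : lmodType R) (f : U -> V) (g : V -> W) : Prop :=
  [/\ injective f, exact_at f g & onto g].

Definition finitely_generated (M : lmodType R) : Prop :=
  exists (n : nat) (g : {linear 'rV[R]_n -> M}), onto g.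

Definition finitely_presented (M : lmodType R) : Prop :=
  exists (m n : nat) (f : {linear 'rV[R]_m -> 'rV[R]_n})
    (g : {linear 'rV[R]_n -> M}), exact_at f g /\ onto g.

Definition projective (P : lmodType R) : Prop :=
  forall (U V : lmodType R) (g : {linear U -> V}) (f : {linear P -> V}),
    onto g -> exists h : {linear P -> U}, forall x, g (h x) = f x.

Definition periodic1 (M : lmodType R) : Prop :=
  exists (P : lmodType R) (f : {linear M -> P}) (g : {linear P -> M}),
    projective P /\ short_exact f g.

Record proj_resolution (M : lmodType R) := ProjResolution {
  res_mod :> nat -> lmodType R;
  res_d : forall n, {linear res_mod n.+1 -> res_mod n};
  res_aug : {linear res_mod 0 -> M};
  res_proj : forall n, projective (res_mod n);
  res_surj : onto res_aug;
  res_exact0 : exact_at (res_d 0) res_aug;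
  res_exact : forall n, exact_at (res_d n.+1) (res_d n) }.

(* Ext^1(M, E) = 0, i.e. H^1(Hom(X, E)) = 0: every 1-cocycle is a
   1-coboundary. Projective resolutions always exist (by free modules) and the
   cohomology does not depend on X, so quantifying over all X is harmless. *)
Definition Ext1_eq0 (M E : lmodType R) : Prop :=
  forall (X : proj_resolution M) (f : {linear X 1 -> E}),
    (forall x, f (res_d X 1 x) = 0) ->
    exists g : {linear X 0 -> E}, forall x, f x = g (res_d X 0 x).

Definition FP_injective (E : lmodType R) : Prop :=
  forall M : lmodType R, finitely_presented M -> Ext1_eq0 M E.

(* A submodule of E is given by its carrier S together with a subtype N on S
   whose module structure makes the inclusion \val : N -> E linear. *)
Definition coherent_module (E : lmodType R) : Prop :=
  forall (S : {pred E}) (N : subLmodType S),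
    finitely_generated N -> finitely_presented N.

Definition simple_module (M : lmodType R) : Prop :=
  (exists x : M, x != 0) /\
  forall S : {pred M}, GRing.submod_closed S ->
    (forall x, x \in S -> x = 0) \/ (forall x, x \in S).

End Modules.

Definition semiregular1 (R : comNzRingType) : Prop :=
  forall M : lmodType R, finitely_presented M -> periodic1 M.

(* Nontriviality 1 != 0 is part of comNzRingType. *)
Definition is_field (R : comNzRingType) : Prop :=
  forall x : R, x != 0 -> exists y, x * y = 1.

(* A \propto E *)
Definition trivext (A : comNzRingType) (E : lmodType A) : Type := (A * E)%type.

Section TrivialExtension.
Variables (A : comNzRingType) (E : lmodType A).
Local Notation T := (trivext E).

HB.instance Definition _ := GRing.Zmodule.copy T (A * E)%type.

Definition trivext_one : T := (1, 0).
Definition trivext_mul (x y : T) : T :=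
  (x.1 * y.1, x.1 *: y.2 + y.1 *: x.2).

Fact trivext_mulA : associative trivext_mul.
Proof.
move=> x y z; congr pair => /=; first exact: mulrA.
by rewrite !scalerDr !scalerA addrA (mulrC z.1 x.1) (mulrC z.1 y.1).
Qed.

Fact trivext_mulC : commutative trivext_mul.
Proof. by move=> x y; congr pair => /=; [exact: mulrC | exact: addrC]. Qed.

Fact trivext_mul1 : left_id trivext_one trivext_mul.
Proof.
by case=> a e; congr pair => /=; rewrite ?mul1r // scale1r scaler0 addr0.
Qed.

Fact trivext_mulDl : left_distributive trivext_mul +%R.
Proof.
move=> x y z; congr pair => /=; first exact: mulrDl.
by rewrite scalerDl scalerDr addrACA.
Qed.

Fact trivext_one_neq0 : trivext_one != 0.
Proof. by rewrite xpair_eqE negb_and oner_neq0. Qed.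

HB.instance Definition _ := GRing.Zmodule_isComNzRing.Build T
  trivext_mulA trivext_mulC trivext_mul1 trivext_mulDl trivext_one_neq0.
End TrivialExtension.

(* The library's prime_idealr are proper ideals; over a commutative ring they
   are exactly the prime ideals.  Localization is at the complement of P. *)
Section Localization.
Variables (A : comNzRingType) (P : prime_idealr A).

Record denom := Denom { den : A; den_notin : den \notin (P : pred A) }.

HB.instance Definition _ := [isSub for den].
HB.instance Definition _ := [Choice of denom by <:].

Fact denom1_subproof : 1 \notin (P : pred A).
Proof. by rewrite idealr1. Qed.
Definition denom1 : denom := Denom denom1_subproof.

Fact denomM_subproof (s t : denom) : den s * den t \notin (P : pred A).
Proof. by rewrite prime_idealrM negb_or !den_notin. Qed.
Definition denomM (s t : denom) : denom := Denom (denomM_subproof s t).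

Section LocMod.
Variable E : lmodType A.

(* e/s = e'/s' iff u (s' e - s e') = 0 for some u outside P. *)
Definition loc_eq (x y : E * denom) : bool :=
  `[< exists u : denom, den u *: (den y.2 *: x.1 - den x.2 *: y.1) = 0 >].

Lemma loc_eqP x y : reflect
  (exists u : denom, (den u * den y.2) *: x.1 = (den u * den x.2) *: y.1)
  (loc_eq x y).
Proof.
apply: (iffP (asboolP _)) => -[u Hu]; exists u.
  by apply/eqP; rewrite -subr_eq0 -!scalerA -scalerBr Hu.
by rewrite scalerBr !scalerA Hu subrr.
Qed.

Fact loc_eq_refl : reflexive loc_eq.
Proof. by move=> x; apply/loc_eqP; exists denom1. Qed.

Fact loc_eq_sym : symmetric loc_eq.
Proof. by move=> x y; apply/loc_eqP/loc_eqP => -[u Hu]; exists u. Qed.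

Fact loc_eq_trans : transitive loc_eq.
Proof.
move=> y x z /loc_eqP[u Hu] /loc_eqP[v Hv]; apply/loc_eqP.
exists (denomM (denomM u v) y.2) => /=.
transitivity ((den v * den z.2) *: ((den u * den y.2) *: x.1)).
  by rewrite scalerA; congr (_ *: _); ring.
rewrite Hu.
transitivity ((den u * den x.2) *: ((den v * den z.2) *: y.1)).
  by rewrite !scalerA; congr (_ *: _); ring.
by rewrite Hv scalerA; congr (_ *: _); ring.
Qed.

Canonical loc_equiv := EquivRel loc_eq loc_eq_refl loc_eq_sym loc_eq_trans.

Definition locmod : Type := {eq_quot loc_eq}.

HB.instance Definition _ : EqQuotient _ loc_eq locmod := EqQuotient.on locmod.
HB.instance Definition _ := Choice.on locmod.

Definition locfrac (e : E) (s : denom) : locmod := \pi_locmod (e, s).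

Lemma locfrac_eqP (e e' : E) (s s' : denom) : reflect
  (exists u : denom, (den u * den s') *: e = (den u * den s) *: e')
  (locfrac e s == locfrac e' s').
Proof.
rewrite /locfrac eqmodE; exact: (loc_eqP (e, s) (e', s')).
Qed.

Lemma locfracW (Q : locmod -> Prop) : (forall e s, Q (locfrac e s)) -> forall x, Q x.
Proof. by move=> HQ; elim/quotW => -[e s]; apply: HQ. Qed.

Lemma locfrac_repr (x : locmod) : locfrac (repr x).1 (repr x).2 = x.
Proof. by rewrite /locfrac -surjective_pairing reprK. Qed.

Definition loc_zero : locmod := locfrac 0 denom1.
Definition loc_opp (x : locmod) : locmod := locfrac (- (repr x).1) (repr x).2.
Definition loc_add (x y : locmod) : locmod :=
  let: (e, s) := repr x in let: (e', s') := repr y in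
  locfrac (den s' *: e + den s *: e') (denomM s s').

Lemma loc_addE e s e' s' :
  loc_add (locfrac e s) (locfrac e' s') =
    locfrac (den s' *: e + den s *: e') (denomM s s').
Proof.
rewrite /loc_add.
have := locfrac_repr (locfrac e s); have := locfrac_repr (locfrac e' s').
case: (repr _) => f' t' /= /eqP/locfrac_eqP[v Hv].
case: (repr _) => f t /= /eqP/locfrac_eqP[u Hu].
apply/eqP/locfrac_eqP; exists (denomM u v) => /=; rewrite !scalerDr !scalerA.
congr (_ + _).
  transitivity ((den v * den s' * den t') *: ((den u * den s) *: f)).
    by rewrite scalerA; congr (_ *: _); ring.
  by rewrite Hu scalerA; congr (_ *: _); ring.
transitivity ((den u * den s * den t) *: ((den v * den s') *: f')).
  by rewrite scalerA; congr (_ *: _); ring.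
by rewrite Hv scalerA; congr (_ *: _); ring.
Qed.

Lemma loc_oppE e s : loc_opp (locfrac e s) = locfrac (- e) s.
Proof.
rewrite /loc_opp.
have := locfrac_repr (locfrac e s); case: (repr _) => f t /= /eqP/locfrac_eqP[u Hu].
by apply/eqP/locfrac_eqP; exists u; rewrite !scalerN Hu.
Qed.

Fact loc_addA : associative loc_add.
Proof.
elim/locfracW=> e s; elim/locfracW=> f t; elim/locfracW=> g w.
rewrite !loc_addE; apply/eqP/locfrac_eqP; exists denom1 => /=.
rewrite !scalerDr !scalerA !addrA.
by congr (_ *: _ + _ *: _ + _ *: _); ring.
Qed.

Fact loc_addC : commutative loc_add.
Proof.
elim/locfracW=> e s; elim/locfracW=> f t; rewrite !loc_addE addrC.
by apply/eqP/locfrac_eqP; exists denom1; rewrite /= [den t * _]mulrC.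
Qed.

Fact loc_add0 : left_id loc_zero loc_add.
Proof.
elim/locfracW=> e s; rewrite loc_addE; apply/eqP/locfrac_eqP; exists denom1 => /=.
by rewrite scaler0 add0r scale1r !mul1r.
Qed.

Fact loc_addN : left_inverse loc_zero loc_opp loc_add.
Proof.
elim/locfracW=> e s; rewrite loc_oppE loc_addE.
apply/eqP/locfrac_eqP; exists denom1 => /=.
by rewrite scalerN addNr !scaler0.
Qed.

HB.instance Definition _ :=
  GRing.isZmodule.Build locmod loc_addA loc_addC loc_add0 loc_addN.

Lemma locfrac_eq0P (e : E) (s : denom) :
  reflect (exists u : denom, den u *: e = 0) (locfrac e s == 0).
Proof.
apply: (iffP (locfrac_eqP _ _ _ _)) => -[u Hu]; exists u.
  by move: Hu; rewrite /= mulr1 scaler0.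
by rewrite /= mulr1 scaler0.
Qed.

End LocMod.

Definition locring : Type := locmod A^o.
HB.instance Definition _ := GRing.Zmodule.on locring.

Section Scale.
Variable E : lmodType A.

Definition loc_scale (x : locring) (y : locmod E) : locmod E :=
  let: (a, s) := repr (x : locmod A^o) in let: (e, t) := repr y in
  locfrac ((a : A) *: e) (denomM s t).

Lemma loc_scaleE (a : A) s (e : E) t :
  loc_scale (locfrac (a : A^o) s) (locfrac e t) = locfrac (a *: e) (denomM s t).
Proof.
rewrite /loc_scale.
have := locfrac_repr (locfrac (a : A^o) s); have := locfrac_repr (locfrac e t).
case: (repr _) => f t' /= /eqP/locfrac_eqP[v Hv].
case: (repr _) => b s' /= /eqP/locfrac_eqP[u Hu].
apply/eqP/locfrac_eqP; exists (denomM u v) => /=; rewrite !scalerA.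
transitivity ((den u * den s * b) *: ((den v * den t) *: f)).
  by rewrite scalerA; congr (_ *: _); ring.
have {}Hu : den u * den s * b = den u * den s' * a := Hu.
by rewrite Hu Hv scalerA; congr (_ *: _); ring.
Qed.

Fact loc_scaleDr : right_distributive loc_scale +%R.
Proof.
elim/locfracW=> a s; elim/locfracW=> e t; elim/locfracW=> f w.
rewrite [locfrac e t + _]loc_addE !loc_scaleE [RHS]loc_addE.
apply/eqP/locfrac_eqP; exists denom1 => /=; rewrite !scalerDr !scalerA.
by congr (_ *: _ + _ *: _); ring.
Qed.

Fact loc_scaleDl y : {morph loc_scale^~ y : a b / a + b}.
Proof.
elim/locfracW: y => e t; elim/locfracW=> a s; elim/locfracW=> b w.
rewrite [locfrac a s + _]loc_addE !loc_scaleE [RHS]loc_addE.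
apply/eqP/locfrac_eqP; exists denom1 => /=.
rewrite !scalerDl !scalerDr !scalerA.
by congr (_ *: _ + _ *: _); rewrite /GRing.scale /=; ring.
Qed.

Fact loc_scale1 : left_id (locfrac (1 : A^o) denom1) loc_scale.
Proof.
elim/locfracW=> e t; rewrite loc_scaleE; apply/eqP/locfrac_eqP; exists denom1 => /=.
by rewrite !scale1r !mul1r.
Qed.

End Scale.

Definition loc_mul (x y : locring) : locring := loc_scale x y.

Fact loc_scaleA (E : lmodType A) (x y : locring) (z : locmod E) :
  loc_scale x (loc_scale y z) = loc_scale (loc_mul x y) z.
Proof.
elim/locfracW: x => a s; elim/locfracW: y => b t; elim/locfracW: z => e w.
rewrite /loc_mul !loc_scaleE; apply/eqP/locfrac_eqP; exists denom1 => /=.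
by rewrite !scalerA; congr (_ *: _); rewrite /GRing.scale /=; ring.
Qed.

Fact loc_mulA : associative loc_mul.
Proof. by move=> x y z; apply: loc_scaleA. Qed.

Fact loc_mulC : commutative loc_mul.
Proof.
elim/locfracW=> a s; elim/locfracW=> b t; rewrite /loc_mul !loc_scaleE.
apply/eqP/locfrac_eqP; exists denom1 => /=.
by rewrite /GRing.scale /=; ring.
Qed.

Fact loc_mul1 : left_id (locfrac (1 : A^o) denom1 : locring) loc_mul.
Proof. exact: loc_scale1. Qed.

Fact loc_mulDl : left_distributive loc_mul +%R.
Proof. by move=> x y z; apply: loc_scaleDl. Qed.

Fact loc_one_neq0 : (locfrac (1 : A^o) denom1 : locring) != 0.
Proof.
apply/negP => /locfrac_eq0P[u Hu]; case/negP: (den_notin u).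
have <- : 0 = den u by rewrite -Hu /GRing.scale /= mulr1.
exact: idealr0.
Qed.

HB.instance Definition _ := GRing.Zmodule_isComNzRing.Build locring
  loc_mulA loc_mulC loc_mul1 loc_mulDl loc_one_neq0.

HB.instance Definition _ (E : lmodType A) :=
  GRing.Zmodule_isLmodule.Build locring (locmod E)
    (@loc_scaleA E) (@loc_scale1 E) (@loc_scaleDr E) (@loc_scaleDl E).

Definition in_Supp (E : lmodType A) : Prop := exists x : locmod E, x != 0.

End Localization.

(* Main.v *)
Require Import Defs.
From HB Require Import structures.
From mathcomp Require Import all_boot all_algebra ring_quotient.
From mathcomp Require Import generic_quotient boolp ring perm classical_sets.
Import GRing.Theory.
Local Open Scope ring_scope.
Local Open Scope quotient_scope.

Set Implicit Arguments.
Unset Strict Implicit.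
Unset Printing Implicit Defensive.

(** The proof replaces 1-semiregularity by an elementwise condition. Call a ring
    element tripartite if the ring splits as a product of three pieces on which
    it is respectively zero, invertible, and an element whose annihilator is the
    ideal it generates. A ring R is 1-semiregular if and only if all of its
    elements are tripartite. (Locally, this says that each localization is a
    field or a chain ring whose only proper nonzero ideal is its maximal ideal.)

    If R is 1-semiregular, a periodicity sequence of the cyclic module R/aR has
    a middle term on two generators; writing that this term is projective gives
    four equations in R, from which the three idempotents are read off
    ([semiregular1_tripartite]).  Conversely, if all elements are tripartite
    then divisibility is total up to an idempotent splitting of R
    ([tripartite_total]), so Gaussian elimination, carried out on each piece and
    glued, diagonalizes every matrix: a finitely presented module is a direct
    sum of cyclic modules R/dR ([diagonal_presentation]), and each summand is
    periodic thanks to the three pieces of d ([tripartite_semiregular1]).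

    The idempotents of the trivial extension are those of A, so that all of its
    elements are tripartite exactly when those of A are and E satisfies
    [locally_simple]: each x in E has an idempotent h with ann(x) = (1 - h)A and
    hE = Ax. It remains to compare this with the conditions on E, over a ring A
    whose elements are all tripartite.  From [locally_simple], the statements on
    localizations are computations with h, which is a unit at every prime where
    x survives; finitely generated submodules of E are cyclic, of the form hA,
    hence finitely presented; and FP-injectivity amounts to solving z = d y
    whenever ann(d) kills z, because presentations can be diagonalized.
    Conversely, coherence makes ann(x) finitely generated, hence generated by an
    idempotent because E vanishes on the square-zero piece of every element of
    A, and hE = Ax holds because it holds at every prime
    ([simple_localizations_locally_simple]). *)

(** * Linear maps, projective modules and quotients *)

Section ModuleTools.
Variable R : comNzRingType.

Lemma linear_bundle (U V : lmodType R) (f : U -> V) :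
  linear f -> exists g : {linear U -> V}, g =1 f.
Proof.
move=> flin.
pose g : {linear U -> V} :=
  HB.pack_for {linear U -> V} f (GRing.isLinear.Build R U V *:%R f flin).
by exists g.
Qed.

Lemma linear_section (U V : lmodType R) (g : {linear U -> V}) :
  onto g -> exists s : V -> U, cancel s g.
Proof. by move=> /choice[s sK]; exists s. Qed.

(** Descends h along the surjection g; this is how maps out of a finitely
    presented module, known only through a presentation, are defined. *)
Lemma linear_factor (U V W : lmodType R) (g : {linear U -> V})
    (h : {linear U -> W}) :
  onto g -> (forall u, g u = 0 -> h u = 0) ->
  exists k : {linear V -> W}, forall u, k (g u) = h u.
Proof.
move=> /linear_section[s sK] gh.
have hE u v : g u = g v -> h u = h v.
  move=> guv; apply/subr0_eq; rewrite -linearB; apply: gh.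
  by rewrite linearB guv subrr.
have [|k kE] := @linear_bundle V W (h \o s).
  by move=> a u v /=; rewrite -linearP; apply: hE; rewrite linearP !sK.
by exists k => u; rewrite kE; apply: hE; rewrite sK.
Qed.

Lemma linear_on_basis (V : lmodType R) n (w : 'I_n -> V) :
  exists f : {linear 'rV[R]_n -> V}, forall v, f v = \sum_i v 0 i *: w i.
Proof.
apply: linear_bundle => a u v; rewrite scaler_sumr -big_split /=.
by apply: eq_bigr => i _; rewrite !mxE scalerDl scalerA.
Qed.

Lemma linear_rowE (V : lmodType R) n (f : {linear 'rV[R]_n -> V}) v :
  f v = \sum_i v 0 i *: f (delta_mx 0 i).
Proof.
by rewrite {1}[v]row_sum_delta linear_sum; apply: eq_bigr => i _; rewrite linearZ.
Qed.

Lemma projective_row n : projective ('rV[R]_n : lmodType R).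
Proof.
move=> U V g f gonto.
have [s sK] := linear_section gonto.
have [h hE] := linear_on_basis (fun i => s (f (delta_mx 0 i))).
exists h => x; rewrite hE (linear_rowE f) linear_sum.
by apply: eq_bigr => i _; rewrite linearZ /= sK.
Qed.

Lemma projective_retract (P F : lmodType R) (i : {linear P -> F})
    (p : {linear F -> P}) : cancel i p -> projective F -> projective P.
Proof.
move=> pK Fproj U V g f gonto.
have [h hE] := Fproj U V g (f \o p)%R gonto.
by exists (h \o i)%R => x; rewrite /= hE /= pK.
Qed.

End ModuleTools.

Section QuotientModule.
Variables (R : comNzRingType) (V : lmodType R) (K : {pred V}).
Hypothesis Kclosed : GRing.submod_closed K.

(** The quotient group is the one of the ideal-quotient construction, which
    needs only a subgroup; scalars act through representatives. *)
Lemma quotient_module : exists (M : lmodType R) (p : {linear V -> M}),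
  onto p /\ forall x, p x = 0 <-> x \in K.
Proof.
have Kzmod : zmod_closed K := GRing.submod_closedB Kclosed.
pose I : zmodClosed V :=
  HB.pack_for (zmodClosed V) K (GRing.isZmodClosed.Build V K Kzmod).
pose Q := Quotient.quot I.
have KZ a x : x \in K -> a *: x \in K.
  by move=> xK; rewrite -[a *: x]addr0; apply: Kclosed.2 => //; exact: Kclosed.1.
have pi_eq x y : \pi_Q x = \pi_Q y <-> x - y \in K.
  by rewrite (rwP eqP) -(Quotient.idealrBE I).
have [sc scE] : exists sc : R -> Q -> Q,
    forall a x, sc a (\pi_Q x) = \pi_Q (a *: x).
  exists (fun a x => \pi_Q (a *: repr x)) => a x.
  by apply/pi_eq; rewrite -scalerBr; apply: KZ; apply/pi_eq; exact: reprK.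
have piD x y : \pi_Q (x + y) = \pi_Q x + \pi_Q y by rewrite !piE.
have scA a b x : sc a (sc b x) = sc (a * b) x.
  by elim/quotW: x => x; rewrite !scE scalerA.
have sc1 : left_id 1 sc by elim/quotW=> x; rewrite scE scale1r.
have scDr : right_distributive sc +%R.
  by move=> a; elim/quotW=> x; elim/quotW=> y; rewrite -piD !scE -piD scalerDr.
have scDl x : {morph sc^~ x : a b / a + b}.
  by elim/quotW: x => x a b; rewrite !scE -piD scalerDl.
pose M : lmodType R := HB.pack_for (lmodType R) Q
  (GRing.Zmodule_isLmodule.Build R Q scA sc1 scDr scDl).
have [|p pE] := @linear_bundle R V M (fun x => \pi_Q x).
  by move=> a x y; rewrite piD -scE.
exists M, p; split=> [y|x]; first by exists (repr (y : Q)); rewrite pE reprK.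
rewrite pE -[x in _ <-> x \in K]subr0 -pi_eq.
by rewrite -(pE 0) linear0.
Qed.

End QuotientModule.

(** * The elementwise form of 1-semiregularity *)

(** The idempotents [e0], [e1], [e2] cut out the pieces on which a is zero, a
    unit, and a square-zero element with annihilator aR. *)
Variant tripartite (R : comNzRingType) (a : R) : Prop :=
  Tripartite (e0 e1 e2 u : R) of
      [/\ e0 + e1 + e2 = 1, e0 * e1 = 0, e0 * e2 = 0 & e1 * e2 = 0]
    & e0 * a = 0 & e1 = a * u & e2 * (a * a) = 0
    & forall r, e2 * (a * r) = 0 -> exists c, e2 * r = a * c.

Lemma orthogonal_idem (R : comNzRingType) (e0 e1 e2 : R) :
  [/\ e0 + e1 + e2 = 1, e0 * e1 = 0, e0 * e2 = 0 & e1 * e2 = 0] ->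
  [/\ e0 * e0 = e0, e1 * e1 = e1 & e2 * e2 = e2].
Proof.
case=> e_sum e01 e02 e12; split; rewrite -[RHS]mulr1 -e_sum !mulrDr.
- by rewrite e01 e02 !addr0.
- by rewrite (mulrC e1 e0) e01 e12 add0r addr0.
- by rewrite (mulrC e2 e0) (mulrC e2 e1) e02 e12 !add0r.
Qed.

Section Semiregular.
Variable R : comNzRingType.

(** Spells out a sequence 0 -> R/aR -> P -> R/aR -> 0: q is the image of the
    generator of the submodule and p lifts the generator of the quotient, so
    that ap lies in the submodule, hence is a multiple of q. *)
Lemma periodic_cyclic_generators (a : R) :
  semiregular1 R ->
  exists (P : lmodType R) (p q : P) (b : R),
    [/\ projective P, (forall y, exists r s, y = r *: p + s *: q),
        (forall r s, r *: p + s *: q = 0 -> exists c, r = a * c),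
        (forall s, s *: q = 0 <-> exists c, s = a * c) & a *: p = b *: q].
Proof.
move=> Rper.
pose K : {pred R^o} := fun x => `[< exists c, x = a * c >].
have KP (x : R) : x \in K <-> exists c, x = a * c.
  by split=> [/asboolP|cx] //; apply/asboolP.
have Kclosed : GRing.submod_closed K.
  split=> [|r x y /KP[c ->] /KP[d ->]]; apply/KP; first by exists 0; rewrite mulr0.
  by exists (r * c + d); rewrite /GRing.scale /=; ring.
have [M [p [ponto pE]]] := quotient_module Kclosed.
have pZ (r s : R) : r *: p s = p (r * s) by rewrite -linearZ.
have Mfp : finitely_presented M.
  have [|f fE] := @linear_bundle R 'rV[R]_1 'rV[R]_1 (fun v => a *: v).
    by move=> r u v; rewrite scalerDr !scalerA mulrC.
  have [|g gE] := @linear_bundle R 'rV[R]_1 M (fun v => p (v 0 0)).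
    by move=> r u v; rewrite !mxE -linearP.
  exists 1%N, 1%N, f, g; split=> [v|y].
    rewrite gE pE KP; split=> [[c vE]|[w <-]]; last first.
      by rewrite fE mxE; exists (w 0 0).
    exists (const_mx c); rewrite fE; apply/matrixP => i j.
    by rewrite !mxE !ord1 -vE.
  by have [x <-] := ponto y; exists (const_mx x); rewrite gE mxE.
have [P [f [g [Pproj [finj fg gonto]]]]] := Rper M Mfp.
have [pp ppE] := gonto (p (1 : R)).
have [b bE] : exists b : R, f (p b) = a *: pp.
  have [|m <-] := (fg (a *: pp)).1; last by have [b <-] := ponto m; exists b.
  by rewrite linearZ /= ppE pZ; apply/pE/KP; exists 1.
have gf m : g (f m) = 0 by apply/fg; exists m.
have qE (s : R) : s *: f (p (1 : R)) = f (p s) by rewrite -linearZ /= pZ mulr1.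
have gp (r : R) : g (r *: pp) = p r by rewrite linearZ /= ppE pZ mulr1.
exists P, pp, (f (p (1 : R))), b; split=> //.
- move=> y; have [r rE] := ponto (g y).
  have [|m mE] := (fg (y - r *: pp)).1.
    by rewrite linearB gp rE subrr.
  have [s sE] := ponto m; exists r, s.
  by rewrite qE sE mE addrC subrK.
- move=> r s /(congr1 g); rewrite linearD gp qE gf addr0 linear0 => pr.
  exact/KP/pE.
- move=> s; rewrite qE -KP -pE; split=> [fs|->]; last by rewrite linear0.
  by apply: finj; rewrite fs linear0.
- by rewrite qE bE.
Qed.

(** The surjection from R^2 onto P = <p, q> has a section h. All relations
    between p and q follow from ap = bq and aq = 0, so h(p) = (1 + ac, - bc + ac')
    and h(q) = (ad, 1 - bd + ad') for some scalars, and a h(q) = 0 together with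
    a h(p) = b h(q) gives four scalar equations. They make a^2 c^2 an idempotent
    on which a is a unit and off which a^2 = 0; there bd is idempotent modulo a
    and fixes a, so lifting it to an idempotent separates the last two pieces. *)
Lemma semiregular1_tripartite : semiregular1 R -> forall a : R, tripartite a.
Proof.
move=> Rper a.
have [P [p [q [b [Pproj gen relp annq apE]]]]] := periodic_cyclic_generators a Rper.
have [|g gE] := @linear_bundle R (R^o * R^o)%type P
    (fun w => (w.1 : R) *: p + (w.2 : R) *: q).
  by move=> r u v /=; rewrite !scalerDl scalerDr !scalerA addrACA.
have gonto : onto g.
  by move=> y; have [r [s ->]] := gen y; exists ((r : R^o), (s : R^o)); rewrite gE.
have [h hK] := Pproj _ _ g idfun gonto.
set P1 : R := (h p).1; pose P2 : R := (h p).2.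
pose Q1 : R := (h q).1; pose Q2 : R := (h q).2.
have hpE : P1 *: p + P2 *: q = p by rewrite -[RHS]hK gE.
have hqE : Q1 *: p + Q2 *: q = q by rewrite -[RHS]hK gE.
have haq : a *: h q = 0.
  by rewrite -linearZ (annq a).2 ?linear0 //; exists 1; rewrite mulr1.
have aQ1 : a * Q1 = 0 by have := congr1 fst haq.
have aQ2 : a * Q2 = 0 by have := congr1 snd haq.
have hap : a *: h p = b *: h q by rewrite -!linearZ /= apE.
have aP1 : a * P1 = b * Q1 by have := congr1 fst hap.
have aP2 : a * P2 = b * Q2 by have := congr1 snd hap.
have rel r s : r *: p + s *: q = 0 ->
    exists c c', r = a * c /\ s = - (b * c) + a * c'.
  move=> rs; have [c rE] := relp r s rs.
  have [c' sE] : exists c', s + b * c = a * c'.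
    by apply/annq; rewrite -rs rE scalerDl addrC (mulrC a) (mulrC b) -!scalerA apE.
  by exists c, c'; split=> //; rewrite -sE; ring.
have [c [c' [P1E P2E]]] : exists c c', P1 - 1 = a * c /\ P2 = - (b * c) + a * c'.
  by apply: rel; rewrite scalerBl scale1r addrAC hpE subrr.
have [d [d' [Q1E Q2E]]] : exists c c', Q1 = a * c /\ Q2 - 1 = - (b * c) + a * c'.
  by apply: rel; rewrite scalerBl scale1r addrA hqE subrr.
have {}P1E : P1 = 1 + a * c by rewrite -P1E; ring.
have {}Q2E : Q2 = 1 - b * d + a * d' by rewrite -(subrK 1 Q2) Q2E; ring.
clear hpE hqE haq hap rel; move: P1 P2 Q1 Q2 P1E P2E Q1E Q2E aQ1 aQ2 aP1 aP2.
move=> _ _ _ _ -> -> -> -> eq1 eq2 eq3 eq4.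
(* As a^2 = - a^3 c, also a^4 c^2 = a^2: the element a^2 c^2 is idempotent. *)
pose e1 := a * (a * c * c).
have a2E : a * a * (1 + a * c) = 0.
  transitivity (b * (a * (a * d))); first by rewrite -mulrA eq3; ring.
  by rewrite eq1 mulr0.
have e1a : (1 - e1) * (a * a) = 0.
  transitivity ((1 - a * c) * (a * a * (1 + a * c))); first by rewrite /e1; ring.
  by rewrite a2E mulr0.
(* Off e1, t - t^2 is a multiple of a, hence squares to 0; the polynomial
   3 t^2 - 2 t^3 lifts such a t to an idempotent since it is congruent to 0
   modulo t^2 and to 1 modulo (1 - t)^2. *)
pose t := b * d; pose e := t * t * (3 - 2 * t).
have at1 : (1 - e1) * (a * (1 - t)) = 0.
  transitivity ((1 - e1) * (a * (1 - b * d + a * d')) - (1 - e1) * (a * a) * d').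
    by rewrite /t; ring.
  by rewrite eq2 e1a; ring.
have [n nE] : exists n, (1 - e1) * (t * (1 - t)) = (1 - e1) * (a * n).
  have eq4' : b * (1 - b * d) = a * (- (b * c) + a * c') - b * a * d'.
    by rewrite eq4; ring.
  exists (d * (- (b * c) + a * c') - d * b * d'); congr (_ * _).
  transitivity (d * (b * (1 - b * d))); first by rewrite /t; ring.
  by rewrite eq4'; ring.
have e1e : (1 - e1) * e1 = 0.
  transitivity ((1 - e1) * (a * a) * (c * c)); first by rewrite /e1; ring.
  by rewrite e1a mul0r.
have ee : (1 - e1) * (e - e * e) = 0.
  pose k := (3 - 2 * t) * (1 + 2 * t).
  transitivity ((1 - e1) * (t * (1 - t)) * (t * (1 - t)) * k).
    by rewrite /k /e; ring.
  transitivity ((1 - e1) * (t * (1 - t)) * (a * n) * k).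
    by rewrite [in LHS]nE; ring.
  rewrite nE; transitivity ((1 - e1) * (a * a) * (n * n * k)); first by ring.
  by rewrite e1a; ring.
have e2e : (1 - e1) * e * ((1 - e1) * e) = (1 - e1) * e.
  transitivity ((1 - e1) * e - (1 - e1) * e1 * (e * e) - (1 - e1) * (e - e * e)).
    by ring.
  by rewrite e1e ee; ring.
apply: (@Tripartite _ _ ((1 - e1) * (1 - e)) e1 ((1 - e1) * e) (a * c * c)) => //.
- split; first by ring.
  + by transitivity ((1 - e1) * e1 * (1 - e)); [ring | rewrite e1e; ring].
  + transitivity ((1 - e1) * ((1 - e1) * (e - e * e))); first by ring.
    by rewrite ee; ring.
  + by transitivity ((1 - e1) * e1 * e); [ring | rewrite e1e; ring].
- transitivity ((1 - e1) * (a * (1 - t)) * (1 - t) * (1 + 2 * t)).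
    by rewrite /e; ring.
  by rewrite at1; ring.
- by transitivity ((1 - e1) * (a * a) * e); [ring | rewrite e1a; ring].
(* If x = e2 r is killed by a, then x b q = x a p = 0, so x b is in aR; and x
   is a multiple of x b since the idempotent e is a multiple of b. *)
- move=> r ar0; have [k xk] : exists k, (1 - e1) * e * r * b = a * k.
    apply/annq; rewrite -scalerA -apE scalerA.
    have -> : (1 - e1) * e * r * a = 0 by rewrite -ar0; ring.
    by rewrite scale0r.
  exists (k * d * (1 - e1) * t * (3 - 2 * t)).
  rewrite -e2e.
  transitivity ((1 - e1) * e * r * b * (d * (1 - e1) * t * (3 - 2 * t))).
    by rewrite {1}/e /t; ring.
  by rewrite xk; ring.
Qed.

End Semiregular.


(** * Diagonal presentations *)

(** Column operations V turn F into a matrix with the same row space as a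
    diagonal one. Row equivalence through X and Y is enough to describe the
    cokernel, and allows the number of rows to vary during elimination. *)
Variant diagonalizable_rows (R : comNzRingType) m n (F : 'M[R]_(m, n)) : Prop :=
  DiagonalizableRows (V V' : 'M[R]_n) (d : 'rV[R]_n)
      (X : 'M[R]_(m, n)) (Y : 'M[R]_(n, m)) of
      V *m V' = 1%:M & V' *m V = 1%:M
    & F *m V = X *m diag_mx d & diag_mx d = Y *m (F *m V).

Section Diagonal.
Variable R : comNzRingType.
Implicit Types e : R.

(** For an idempotent e, the ring splits as eR x (1 - e)R, and this is the
    matrix that is A on the first factor and B on the second. *)
Definition patch e m n (A B : 'M[R]_(m, n)) := e *: A + (1 - e) *: B.

Lemma mul_patch e m n p (A B : 'M[R]_(m, n)) (C D : 'M[R]_(n, p)) :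
  e * e = e -> patch e A B *m patch e C D = patch e (A *m C) (B *m D).
Proof.
move=> ee; have ef : e * (1 - e) = 0 by rewrite mulrBr mulr1 ee subrr.
have ff : (1 - e) * (1 - e) = 1 - e by rewrite mulrBl mul1r ef subr0.
rewrite /patch mulmxDl !mulmxDr -!scalemxAl -!scalemxAr !scalerA ee ef ff.
by rewrite (mulrC (1 - e)) ef !scale0r addr0 add0r.
Qed.

Lemma patchxx e m n (A : 'M[R]_(m, n)) : patch e A A = A.
Proof. by rewrite /patch -scalerDl addrC subrK scale1r. Qed.

Lemma patch_scale e m n (A B : 'M[R]_(m, n)) :
  e * e = e -> patch e (e *: A) ((1 - e) *: B) = patch e A B.
Proof.
move=> ee; rewrite /patch !scalerA ee.
suff -> : (1 - e) * (1 - e) = 1 - e by [].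
by transitivity (1 - e - e + e * e); [ring | rewrite ee; ring].
Qed.

Lemma diag_mx_patch e n (A B : 'rV[R]_n) :
  diag_mx (patch e A B) = patch e (diag_mx A) (diag_mx B).
Proof. by rewrite /patch linearD !linearZ. Qed.

Lemma diagonalizable_rows_glue e m n (F : 'M[R]_(m, n)) : e * e = e ->
  diagonalizable_rows (e *: F) -> diagonalizable_rows ((1 - e) *: F) ->
  diagonalizable_rows F.
Proof.
move=> ee [V1 W1 d1 X1 Y1 VW1 WV1 FV1 dY1] [V2 W2 d2 X2 Y2 VW2 WV2 FV2 dY2].
have FVE : F *m patch e V1 V2 = patch e (e *: F *m V1) ((1 - e) *: F *m V2).
  by rewrite -{1}(patchxx e F) mul_patch // -!scalemxAl patch_scale.
apply: (@DiagonalizableRows _ _ _ _ (patch e V1 V2) (patch e W1 W2) (patch e d1 d2)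
  (patch e X1 X2) (patch e Y1 Y2)).
- by rewrite mul_patch // VW1 VW2 patchxx.
- by rewrite mul_patch // WV1 WV2 patchxx.
- by rewrite FVE diag_mx_patch mul_patch // FV1 FV2.
- by rewrite FVE diag_mx_patch mul_patch // -dY1 -dY2.
Qed.

Lemma diagonalizable_rows_equiv m p n (F : 'M[R]_(m, n)) (G : 'M[R]_(p, n))
    (W W' : 'M[R]_n) (S : 'M[R]_(m, p)) (T : 'M[R]_(p, m)) :
  W *m W' = 1%:M -> W' *m W = 1%:M -> F *m W = S *m G -> G = T *m (F *m W) ->
  diagonalizable_rows G -> diagonalizable_rows F.
Proof.
move=> WW' W'W FW GE [V V' d X Y VV' V'V GV dE].
apply: (@DiagonalizableRows _ _ _ _ (W *m V) (V' *m W') d (S *m X) (Y *m T)).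
- by rewrite mulmxA -(mulmxA W) VV' mulmx1 ?WW'.
- by rewrite mulmxA -(mulmxA V') W'W mulmx1 ?V'V.
- by rewrite mulmxA FW -mulmxA GV mulmxA.
- by rewrite dE [F *m _]mulmxA -mulmxA; congr (_ *m _); rewrite mulmxA -GE.
Qed.

Lemma diagonalizable_rows_block m n (p : R) (F : 'M[R]_(m, n)) :
  diagonalizable_rows F ->
  diagonalizable_rows (block_mx p%:M 0 0 F : 'M[R]_(1 + m, 1 + n)).
Proof.
move=> [V V' d X Y VV' V'V FV dE].
apply: (@DiagonalizableRows _ _ _ _ (block_mx 1%:M 0 0 V) (block_mx 1%:M 0 0 V')
  (row_mx p%:M d) (block_mx 1%:M 0 0 X) (block_mx 1%:M 0 0 Y)).
- by rewrite mulmx_block !mulmx0 !mul0mx !mul1mx !addr0 !add0r VV' -scalar_mx_block.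
- by rewrite mulmx_block !mulmx0 !mul0mx !mul1mx !addr0 !add0r V'V -scalar_mx_block.
- rewrite diag_mx_row !mulmx_block !mulmx0 !mul0mx !mul1mx !addr0 !add0r FV mulmx1.
  by congr block_mx; apply/matrixP => i j; rewrite !mxE !ord1.
- rewrite diag_mx_row !mulmx_block !mulmx0 !mul0mx !mul1mx !addr0 !add0r -dE.
  rewrite mulmx1 mulmx0.
  by congr block_mx; apply/matrixP => i j; rewrite !mxE !ord1.
Qed.

(** Swapping columns brings the pivot to the first column; since it divides its
    row and its column, both are cleared, leaving a matrix with one column
    less. *)
Lemma diagonalizable_rows_pivot m n (F : 'M[R]_(m, n.+1)) i0 j0 :
  (forall i j, exists c, F i j = F i0 j0 * c) ->
  (forall F' : 'M[R]_(m, n), diagonalizable_rows F') -> diagonalizable_rows F.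
Proof.
move=> piv IH.
have [Q QE] : exists Q, forall i j, F i j = F i0 j0 * Q i j.
  have /choice[Q QE] ij : exists c, F ij.1 ij.2 = F i0 j0 * c by exact: piv.
  by exists (fun i j => Q (i, j)) => i j; rewrite -(QE (i, j)).
wlog j00 : F j0 Q {piv} QE / j0 = 0.
  move=> W0; pose T : 'M[R]_n.+1 := tperm_mx 0 j0.
  have TT : T *m T = 1%:M by rewrite -perm_mxM tperm2 perm_mx1.
  have FT i j : (F *m T) i j = F i (tperm 0 j0 j).
    by rewrite -(xcolE 0 j0) mxE.
  apply: (@diagonalizable_rows_equiv _ _ _ _ (F *m T) T T 1%:M 1%:M) => //.
  - by rewrite mul1mx.
  - by rewrite mul1mx.
  - apply: (W0 (F *m T) 0 (fun i j => Q i (tperm 0 j0 j))) => // i j.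
    by rewrite !FT tpermL QE.
subst j0; pose p := F i0 0.
pose f : 'cV[R]_m := lsubmx (F : 'M_(m, 1 + n)).
pose F2 : 'M[R]_(m, n) := rsubmx (F : 'M_(m, 1 + n)).
pose c : 'rV[R]_n := \row_j Q i0 (rshift 1 j).
pose g : 'cV[R]_m := \col_i Q i 0.
pose D : 'rV[R]_m := delta_mx 0 i0.
have fg : g *m p%:M = f.
  rewrite mul_mx_scalar; apply/matrixP => i j; rewrite !mxE !ord1 -QE.
  by congr (F i _); exact: val_inj.
have DM k (A : 'M[R]_(m, k)) : D *m A = row i0 A by rewrite rowE.
have Df : D *m f = p%:M.
  rewrite DM; apply/matrixP => i j; rewrite !mxE !ord1 /p mulr1n.
  by congr (F _ _); exact: val_inj.
have DF2 : D *m F2 = p%:M *m c.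
  by rewrite DM mul_scalar_mx; apply/matrixP => i j; rewrite !mxE QE.
(* B clears the row of the pivot, the one selected by D. *)
pose B : 'M[R]_(1 + n) := block_mx 1%:M (- c) 0 1%:M.
pose B' : 'M[R]_(1 + n) := block_mx 1%:M c 0 1%:M.
have FB : F *m B = row_mx f (F2 - f *m c).
  transitivity (row_mx f F2 *m B); first by rewrite hsubmxK.
  rewrite mul_row_block !mulmx1 mulmx0 addr0.
  by rewrite mulmxN addrC.
have DFB : D *m (F2 - f *m c) = 0 by rewrite mulmxBr DF2 mulmxA Df subrr.
apply: (@diagonalizable_rows_equiv _ _ _ _ (block_mx p%:M 0 0 (F2 - f *m c)) B B'
  (row_mx g 1%:M) (col_mx D (1%:M - g *m D))).
- rewrite mulmx_block !mulmx0 !mul0mx !mulmx1 !mul1mx !addr0 !add0r subrr.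
  by rewrite -scalar_mx_block.
- rewrite mulmx_block !mulmx0 !mul0mx !mulmx1 !mul1mx !addr0 !add0r addNr.
  by rewrite -scalar_mx_block.
- by rewrite FB mul_row_block !mulmx0 mul1mx addr0 add0r fg.
- rewrite FB mul_col_row DFB Df mulmxBl mul1mx -mulmxA Df fg subrr.
  by rewrite mulmxBl mul1mx -mulmxA DFB mulmx0 subr0.
- exact: diagonalizable_rows_block.
Qed.

Hypothesis Rtri : forall a : R, tripartite a.

(** Only the piece where a and b are both of the third kind is not immediate.
    There ab is nilpotent, so that it is zero or of the third kind. If ab = 0,
    then b is in ann(a) = aR. If ann(ab) = abR, then a, which kills ab, is a
    multiple of ab, hence zero as b is nilpotent; then ann(a) = aR is both the
    unit and the zero ideal. *)
Lemma tripartite_total (a b : R) : exists g : R,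
  [/\ g * g = g, exists c, g * b = a * c & exists c, (1 - g) * a = b * c].
Proof.
have [e0 e1 e2 u e_orth e0a e1E e2a annE] := Rtri a.
have [f0 f1 f2 v f_orth f0b f1E f2b _] := Rtri b.
have [k0 k1 k2 w k_orth k0ab k1E k2ab annK] := Rtri (a * b).
have [e00 e11 e22] := orthogonal_idem e_orth.
have [e_sum e01 e02 e12] := e_orth.
have [f00 f11 f22] := orthogonal_idem f_orth.
have [f_sum f01 f02 f12] := f_orth.
have [k00 k11 k22] := orthogonal_idem k_orth.
have [k_sum k01 k02 k12] := k_orth.
have e2k1 : e2 * k1 = 0.
  rewrite -k11; transitivity (e2 * (a * a) * (b * b * w * w)).
    by rewrite k1E; ring.
  by rewrite e2a mul0r.
(* The piece where a, b and ab are all of the third kind is empty. *)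
pose z := e2 * k2 * f2.
have zz : z * z = z.
  transitivity (e2 * e2 * (k2 * k2) * (f2 * f2)); first by rewrite /z; ring.
  by rewrite e22 k22 f22.
have za : z * a = 0.
  have [|c cE] := annK (e2 * a).
    by transitivity (k2 * b * (e2 * (a * a))); [ring | rewrite e2a mulr0].
  have zabc : z * a = z * a * b * c.
    rewrite -{1}zz; transitivity (z * f2 * (k2 * (e2 * a))).
      by rewrite /z; ring.
    rewrite cE; transitivity (e2 * k2 * (f2 * f2) * a * b * c).
      by rewrite /z; ring.
    by rewrite f22.
  rewrite zabc zabc; transitivity (e2 * k2 * a * c * c * (f2 * (b * b))).
    by rewrite /z; ring.
  by rewrite f2b mulr0.
have z0 : z = 0.
  have [|c cE] := annE z; first by rewrite (mulrC a) za mulr0.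
  transitivity (z * (e2 * z)); last by rewrite cE mulrA za mul0r.
  transitivity (e2 * z * z); last by ring.
  by rewrite -mulrA zz /z -!mulrA (mulrA e2 e2) e22.
have [c cE] : exists c, e2 * (k0 * b) = a * c.
  by apply: annE; transitivity (e2 * (k0 * (a * b))); [ring | rewrite k0ab mulr0].
exists (e1 + e2 * (f0 + f2)); split.
- transitivity (e1 * e1 + 2 * (e1 * e2) * (f0 + f2) +
      e2 * e2 * (f0 * f0 + 2 * (f0 * f2) + f2 * f2)); first by ring.
  by rewrite e11 e12 e22 f00 f02 f22; ring.
- exists (u * b + f2 * c).
  transitivity (e1 * b + e2 * (f0 * b) + e2 * f2 * b * 1); first by ring.
  rewrite -k_sum f0b {1}e1E.
  transitivity (a * u * b + f2 * (e2 * (k0 * b)) + e2 * k1 * (f2 * b) + z * b).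
    by rewrite /z; ring.
  by rewrite cE e2k1 z0; ring.
- exists (e2 * v * a).
  transitivity ((e0 + e1 + e2 - (e1 + e2 * (f0 + f2))) * a).
    by rewrite e_sum.
  transitivity (e0 * a + e2 * (f0 + f1 + f2 - f0 - f2) * a).
    by rewrite f_sum; ring.
  by rewrite e0a; transitivity (e2 * f1 * a); [ring | rewrite f1E; ring].
Qed.

(** Induction on the number of columns. To find a pivot, the entries are compared
    one by one with the current candidate k0, the list s holding those not
    yet compared: each comparison splits the ring in two pieces, on which one
    or the other of the two entries becomes the candidate. *)
Lemma diagonalizable_rows_all m n (F : 'M[R]_(m, n)) : diagonalizable_rows F.
Proof.
elim: n m F => [|n IH] m F.
  by apply: (@DiagonalizableRows _ _ _ _ 1%:M 1%:M 0 0 0);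
    rewrite ?mulmx1 // [LHS]thinmx0 [RHS]thinmx0.
case: m F => [|m] F.
  apply: (@DiagonalizableRows _ _ _ _ 1%:M 1%:M 0 0 0); rewrite ?mulmx1 //.
    by rewrite [LHS]flatmx0 [RHS]flatmx0.
  by rewrite mul0mx linear0.
suff: forall (s : seq ('I_m.+1 * 'I_n.+1)) (k0 : 'I_m.+1 * 'I_n.+1)
    (G : 'M[R]_(m.+1, n.+1)),
    (forall k, k \notin s -> exists c, G k.1 k.2 = G k0.1 k0.2 * c) ->
    diagonalizable_rows G.
  by move=> /(_ (enum {: 'I_m.+1 * 'I_n.+1}) (0, 0)); apply=> k; rewrite mem_enum.
elim=> [|k s IHs] k0 G div.
  apply: (@diagonalizable_rows_pivot _ _ G k0.1 k0.2) => // i j.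
  exact: (div (i, j)).
have [e [ee [c cE] [c' c'E]]] := tripartite_total (G k0.1 k0.2) (G k.1 k.2).
have e'e' : (1 - e) * (1 - e) = 1 - e.
  by transitivity (1 - e - e + e * e); [ring | rewrite ee; ring].
apply: (diagonalizable_rows_glue ee).
- apply: (IHs k0) => l ls; rewrite !mxE.
  have [->|lk] := eqVneq l k; first by exists c; rewrite -{1}ee -mulrA cE; ring.
  have [|q ->] := div l; first by rewrite inE negb_or lk.
  by exists q; ring.
- apply: (IHs k) => l ls; rewrite !mxE.
  have [->|lk] := eqVneq l k; first by exists 1; rewrite mulr1.
  have [|q ->] := div l; first by rewrite inE negb_or lk.
  exists (c' * q); rewrite -{1}e'e'.
  transitivity ((1 - e) * ((1 - e) * G k0.1 k0.2) * q); first by ring.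
  by rewrite c'E; ring.
Qed.

End Diagonal.

Section Presentation.
Variable R : comNzRingType.
Hypothesis Rtri : forall a : R, tripartite a.

Lemma diagonal_presentation (M : lmodType R) : finitely_presented M ->
  exists n (g : {linear 'rV[R]_n -> M}) (d : 'I_n -> R), onto g /\
    forall v, g v = 0 <-> exists w : 'I_n -> R, forall i, v 0 i = d i * w i.
Proof.
move=> [m [n [f [g [fg gonto]]]]].
have [V V' d X Y VV' V'V FV dE] := diagonalizable_rows_all Rtri (lin1_mx f).
exists n, (g \o mulmxr V')%R, (d 0); split=> [y|v].
  by have [x <-] := gonto y; exists (x *m V); rewrite /= -mulmxA VV' mulmx1.
rewrite /= fg; split=> [[x xE]|[w wE]].
  exists (fun i => (x *m X) 0 i) => i.
  have -> : v = x *m X *m diag_mx d.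
    by rewrite -mulmxA -FV mulmxA mul_rV_lin1 xE -mulmxA V'V mulmx1.
  by rewrite mul_mx_diag mxE mulrC.
exists (\row_i w i *m Y); rewrite -mul_rV_lin1.
have -> : v = \row_i w i *m diag_mx d.
  by apply/rowP => i; rewrite mul_mx_diag !mxE wE mulrC.
by rewrite dE !mulmxA -(mulmxA _ V) VV' mulmx1.
Qed.

(** The image of an idempotent endomorphism, realized as the quotient by its
    kernel. *)
Lemma projective_image (F : lmodType R) (eps : {linear F -> F}) :
  projective F -> (forall x, eps (eps x) = eps x) ->
  exists (P : lmodType R) (i : {linear P -> F}) (p : {linear F -> P}),
    [/\ projective P, cancel i p & forall x, i (p x) = eps x].
Proof.
move=> Fproj epsK.
have [|P [p [ponto pE]]] := @quotient_module R F [pred x | eps x == 0].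
  split=> [|a x y]; rewrite !inE ?linear0 // linearP.
  by move=> /eqP-> /eqP->; rewrite scaler0 addr0.
have [|i iE] := @linear_factor R F P F p eps ponto.
  by move=> x /pE/eqP.
have iK : cancel i p.
  move=> y; have [x <-] := ponto y; apply/subr0_eq; rewrite -linearB; apply/pE.
  by rewrite iE inE linearB epsK subrr.
by exists P, i, p; split=> //; apply: projective_retract iK Fproj.
Qed.

Lemma projective_row_pair n :
  projective ('rV[R]_n * 'rV[R]_n)%type.
Proof.
have [|i iE] := @linear_bundle R ('rV[R]_n * 'rV[R]_n)%type 'rV[R]_(n + n)
  (fun x => row_mx x.1 x.2).
  by move=> a x y; rewrite scale_row_mx add_row_mx.
have [|p pE] := @linear_bundle R 'rV[R]_(n + n) ('rV[R]_n * 'rV[R]_n)%type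
  (fun x => (lsubmx x, rsubmx x)).
  by move=> a x y; rewrite !linearP.
apply: (@projective_retract _ _ _ i p); last exact: projective_row.
by move=> [x y]; rewrite iE pE row_mxKl row_mxKr.
Qed.

(** For M = R/dR the middle term is P = (e0 + e2)R x e0 R, with the map
    r |-> (e2 d r, e0 r) from M and (u, v) |-> u to M: this is R -> R^2 -> R on the piece where d = 0,
    zero where d is a unit, and R/dR -> R -> R/dR, through multiplication by d,
    where ann(d) = dR. A diagonal presentation gives one such P for each
    coordinate. *)
Lemma tripartite_semiregular1 : semiregular1 R.
Proof.
move=> M /diagonal_presentation[n [g [d [gonto gE]]]].
have : forall i, exists t : R * R * R * R, let: (e0, e1, e2, u) := t in
    [/\ [/\ e0 + e1 + e2 = 1, e0 * e0 = e0, e2 * e2 = e2 & e0 * e2 = 0],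
        e0 * d i = 0, e1 = d i * u, e2 * (d i * d i) = 0
      & forall r, e2 * (d i * r) = 0 -> exists c, e2 * r = d i * c].
  move=> i; have [e0 e1 e2 u e_orth e0d e1E e2d ann] := Rtri (d i).
  have [e00 _ e22] := orthogonal_idem e_orth; have [e_sum _ e02 _] := e_orth.
  by exists (e0, e1, e2, u).
move=> /choice[t]; pose e0 i := (t i).1.1.1; pose e1 i := (t i).1.1.2.
pose e2 i := (t i).1.2; pose u i := (t i).2 => tE.
have {tE} H i : [/\ [/\ e0 i + e1 i + e2 i = 1, e0 i * e0 i = e0 i,
    e2 i * e2 i = e2 i & e0 i * e2 i = 0], e0 i * d i = 0, e1 i = d i * u i,
    e2 i * (d i * d i) = 0
  & forall r, e2 i * (d i * r) = 0 -> exists c, e2 i * r = d i * c].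
  by rewrite /e0 /e1 /e2 /u; move: (tE i); case: (t i) => [[[? ?] ?] ?].
clearbody e0 e1 e2 u; clear t.
pose row2 : lmodType R := ('rV[R]_n * 'rV[R]_n)%type.
have [|eps epsE] := @linear_bundle R row2 row2 (fun x =>
    (\row_i ((e0 i + e2 i) * x.1 0 i), \row_i (e0 i * x.2 0 i))).
  by move=> a x y; congr pair; apply/rowP => i; rewrite !mxE /=; ring.
have [|x|P [i [p [Pproj iK pK]]]] := @projective_image row2 eps.
- exact: projective_row_pair.
- rewrite !epsE; congr pair; apply/rowP => i; rewrite !mxE /=.
    have [[_ e00 e22 e02] _ _ _ _] := H i.
    rewrite mulrA; congr (_ * _).
    by rewrite mulrDl !mulrDr e00 e22 (mulrC (e2 i)) e02; ring.
  by have [[_ e00 _ _] _ _ _ _] := H i; rewrite mulrA e00.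
have [|f' f'E] := @linear_bundle R 'rV[R]_n P (fun r =>
    p (\row_i (e2 i * d i * r 0 i), \row_i (e0 i * r 0 i))).
  move=> a x y; rewrite -linearP; congr (p _); congr pair;
  by apply/rowP => j; rewrite !mxE /=; ring.
have if' r : i (f' r) = (\row_i (e2 i * d i * r 0 i), \row_i (e0 i * r 0 i)).
  rewrite f'E pK epsE; congr pair; apply/rowP => j; rewrite !mxE /=.
    have [[_ e00 e22 e02] _ _ _ _] := H j.
    by rewrite mulrDl !mulrA e02 e22; ring.
  by have [[_ e00 e22 e02] _ _ _ _] := H j; rewrite !mulrA e00.
have f'0 r : f' r = 0 <-> g r = 0.
  rewrite gE; split=> [/(congr1 i)|[w wE]].
    rewrite linear0 if' => -[/rowP r1 /rowP r2].
    suff /choice[w wE] : forall j, exists c, r 0 j = d j * c by exists w.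
    move=> j; have [[e_sum _ _ _] _ e1E _ ann] := H j.
    have [|c cE] := ann (r 0 j); first by have := r1 j; rewrite !mxE mulrA.
    exists (u j * r 0 j + c); rewrite mulrDr -cE mulrA -e1E -[LHS]mul1r -e_sum.
    by have := r2 j; rewrite !mxE !mulrDl => ->; ring.
  rewrite -[f' r]iK if' -(linear0 p); congr (p _); congr pair; apply/rowP => j.
    have [_ _ _ e2d _] := H j; rewrite !mxE wE.
    by transitivity (e2 j * (d j * d j) * w j); [ring | rewrite e2d mul0r].
  by have [_ e0d _ _ _] := H j; rewrite !mxE wE mulrA e0d mul0r.
have [|f fE] := @linear_factor R _ _ _ g f' gonto; first by move=> r /f'0.
have [|h hE] := @linear_bundle R P M (fun y => g (i y).1).
  by move=> a x y; rewrite !linearP.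
exists P, f, h; split=> //; split.
- move=> x y; have [r <-] := gonto x; have [s <-] := gonto y; rewrite !fE => rs.
  apply/subr0_eq; rewrite -linearB; apply/f'0.
  by rewrite linearB rs subrr.
- move=> y; rewrite hE gE; split=> [[w wE]|[m <-]].
    pose r : 'rV[R]_n := \row_j (e2 j * w j + e0 j * (i y).2 0 j).
    exists (g r); rewrite fE -[LHS]iK if' -[RHS]iK; congr (p _).
    have iyE : i y = eps (i y) by rewrite -pK iK.
    have y1E j : (i y).1 0 j = (e0 j + e2 j) * (i y).1 0 j.
      by rewrite {1}iyE epsE mxE.
    have y2E j : (i y).2 0 j = e0 j * (i y).2 0 j.
      by rewrite {1}iyE epsE mxE.
    rewrite [RHS]surjective_pairing; congr pair; apply/rowP => j;
      have [[_ e00 e22 e02] e0d _ _ _] := H j.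
      rewrite [RHS]y1E !mxE wE.
      transitivity (e2 j * e2 j * d j * w j + e0 j * e2 j * d j * (i y).2 0 j).
        by ring.
      rewrite e22 e02; transitivity ((e0 j * d j) * w j + e2 j * d j * w j).
        by rewrite e0d; ring.
      by ring.
    rewrite [RHS]y2E !mxE.
    transitivity (e0 j * e2 j * w j + e0 j * e0 j * (i y).2 0 j); first by ring.
    by rewrite e00 e02; ring.
  have [r <-] := gonto m; exists (fun j => e2 j * r 0 j) => j.
  by rewrite fE if' /= mxE; ring.
- move=> m; have [r <-] := gonto m; exists (p (r, 0)).
  rewrite hE pK epsE /=; apply/esym/subr0_eq; rewrite -linearB; apply/gE.
  exists (fun j => u j * r 0 j) => j; rewrite !mxE.
  have [[e_sum _ _ _] _ e1E _ _] := H j.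
  rewrite mulrA -e1E; transitivity ((1 - e0 j - e2 j) * r 0 j); first by ring.
  by rewrite -e_sum; ring.
Qed.

End Presentation.

(** A cocycle f is a map K -> E on the kernel K of X_0 -> M. Comparing X_0 with a
    diagonal presentation R^n -> M through lifts in both directions reduces the
    extension of f to the one of a map on the sum of the ideals a_i R, where it
    amounts to dividing by the a_i. *)
Lemma divisible_FP_injective (R : comNzRingType) (E : lmodType R) :
  (forall a : R, tripartite a) ->
  (forall (a : R) (z : E), (forall r, a * r = 0 -> r *: z = 0) ->
     exists y, z = a *: y) ->
  FP_injective E.
Proof.
move=> Rtri Ediv M Mfp X f fd.
have [n [g [a [gonto gE]]]] := diagonal_presentation Rtri Mfp.
pose d0 := res_d X 0; pose aug := res_aug X.
have aug_d0 x : aug (d0 x) = 0 by apply/res_exact0; exists x.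
have f_d0 x y : d0 x = d0 y -> f x = f y.
  move=> xy; apply/subr0_eq; rewrite -linearB.
  have [|w <-] := (@res_exact _ _ X 0 (x - y)).1; last exact: fd.
  by rewrite linearB; apply/eqP; rewrite subr_eq0; apply/eqP.
have [s sP] : exists s : X 0 -> X 1, forall x, aug x = 0 -> d0 (s x) = x.
  have /choice[s sP] x : exists y : X 1, aug x = 0 -> d0 y = x.
    have [/res_exact0[y yx]|nx] := EM (aug x = 0); first by exists y.
    by exists 0.
  by exists s.
have [al alE] := projective_row g (@res_surj _ _ X).
have [be beE] := @res_proj _ _ X 0 _ _ g aug gonto.
pose z i := a i *: (delta_mx 0 i : 'rV[R]_n).
have aug_z i : aug (al (z i)) = 0.
  rewrite alE; apply/gE; exists (fun j => (j == i)%:R) => j.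
  by rewrite !mxE eqxx /=; case: eqVneq => [->|]; rewrite ?mulr0.
have /choice[y yE] i : exists y, f (s (al (z i))) = a i *: y.
  apply: Ediv => r ar; rewrite -linearZ -(linear0 f); apply: f_d0.
  by rewrite linearZ linear0 /= sP // -linearZ /= scalerA mulrC ar scale0r linear0.
have [psi psiE] := linear_on_basis y.
have psi_f v : g v = 0 -> psi v = f (s (al v)).
  move=> gv; have [w wE] := (gE v).1 gv; rewrite psiE.
  transitivity (f (\sum_i w i *: s (al (z i)))).
    rewrite linear_sum; apply: eq_bigr => i _.
    by rewrite linearZ /= yE scalerA wE mulrC.
  apply: f_d0; rewrite sP ?alE // (linear_rowE al) linear_sum.
  apply: eq_bigr => i _.
  by rewrite linearZ /= sP // wE /z linearZ /= scalerA mulrC.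
have aug_id x : aug (x - al (be x)) = 0 by rewrite linearB alE beE subrr.
(* On x, the map f sees the part of x in K, and psi the part coming from R^n. *)
have [|h hE] := @linear_bundle R (X 0) E
    (fun x => f (s (x - al (be x))) + psi (be x)).
  move=> r u v; have -> : r *: u + v - al (be (r *: u + v)) =
      r *: (u - al (be u)) + (v - al (be v)).
    by rewrite (linearP be) (linearP al) opprD addrACA scalerBr.
  rewrite (linearP be) (linearP psi) [in RHS]scalerDr addrACA; congr (_ + _).
  rewrite -(linearP f); apply: f_d0; rewrite (linearP d0) /= !sP ?aug_id //.
  by rewrite (linearP aug) !aug_id scaler0 addr0.
exists h => x; rewrite hE psi_f ?beE //.
rewrite -linearD; apply: f_d0; rewrite linearD !sP ?alE ?beE //.
by rewrite subrK.
Qed.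

(** * The trivial extension *)

Section TrivialExtensionCriterion.
Variables (A : comNzRingType) (E : lmodType A).

(** At a prime P, either h becomes 0 in A_P and so does x in E_P, or h becomes 1
    and E_P is free on x. *)
Definition locally_simple : Prop :=
  forall x : E, exists h : A, [/\ h * h = h, h *: x = x,
    forall r, r *: x = 0 -> h * r = 0 & forall y, exists c, h *: y = c *: x].

Implicit Types e x y : trivext E.

Lemma trivext_mulE e x : e * x = (e.1 * x.1, e.1 *: x.2 + x.1 *: e.2).
Proof. by []. Qed.

Lemma trivext_addE e x : e + x = (e.1 + x.1, e.2 + x.2).
Proof. by []. Qed.

Lemma trivext_fst x y : x = y -> x.1 = y.1. Proof. by move->. Qed.
Lemma trivext_snd x y : x = y -> x.2 = y.2. Proof. by move->. Qed.

Lemma trivext_idem e : e * e = e -> e.2 = 0.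
Proof.
move=> ee; have e1 : e.1 * e.1 = e.1 by rewrite -[in RHS]ee.
have e2 : e.1 *: e.2 + e.1 *: e.2 = e.2 by rewrite -[in RHS]ee.
have e10 : e.1 *: e.2 = 0.
  have := congr1 (fun z => e.1 *: z) e2.
  rewrite scalerDr scalerA e1 => /eqP.
  by rewrite -subr_eq0 addrK => /eqP.
by rewrite -e2 e10 addr0.
Qed.

Lemma trivext_tripartite_base :
  (forall x : trivext E, tripartite x) -> forall a : A, tripartite a.
Proof.
move=> Etri a.
have [e0 e1 e2 u e_orth e0a e1E e2a ann] := Etri (a, 0).
have [e00 e11 e22] := orthogonal_idem e_orth.
have [e_sum e01 e02 e12] := e_orth.
have e2_0 := trivext_idem e22.
apply: (@Tripartite _ _ e0.1 e1.1 e2.1 u.1).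
- by split; [exact: trivext_fst e_sum | exact: trivext_fst e01
            | exact: trivext_fst e02 | exact: trivext_fst e12].
- exact: trivext_fst e0a.
- exact: trivext_fst e1E.
- exact: trivext_fst e2a.
- move=> r r0; have [|c cE] := ann (r, 0).
    by rewrite !trivext_mulE /= r0 e2_0 !(scaler0, addr0).
  by exists c.1; exact: trivext_fst cE.
Qed.

(** For (0, x) the unit piece is empty because (0, x) is nilpotent, and h is the
    idempotent of the third piece: the annihilator of (0, x) there is the set of
    its multiples (0, cx). *)
Lemma trivext_tripartite_module :
  (forall x : trivext E, tripartite x) -> locally_simple.
Proof.
move=> Etri x.
have [e0 e1 e2 u e_orth e0a e1E e2a ann] := Etri (0, x).
have [e00 e11 e22] := orthogonal_idem e_orth.
have [e_sum e01 e02 e12] := e_orth.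
have e2_0 := trivext_idem e22.
have e1_0 : e1.1 = 0 by rewrite e1E /= mul0r.
exists e2.1; split.
- exact: trivext_fst e22.
- have -> : e2.1 = 1 - e0.1.
    by have /= <- := trivext_fst e_sum; rewrite e1_0; ring.
  rewrite scalerBl scale1r; have /= := trivext_snd e0a.
  by rewrite scale0r addr0 => ->; rewrite subr0.
- move=> r rx; have [|c /trivext_fst /=] := ann (r, 0).
    by rewrite !trivext_mulE /= rx e2_0 mul0r mulr0 !scaler0 !addr0 scaler0.
  by rewrite mul0r.
- move=> y; have [|c /trivext_snd /=] := ann (0, y).
    by rewrite !trivext_mulE /= e2_0 !mulr0 !scale0r !addr0 !scaler0.
  by rewrite !scale0r !addr0 add0r => ->; exists c.1.
Qed.

(** On the piece e, a^2 = 0 and ann(a) = aA. For y in E, the element ay is killed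
    by a, while the ring acts faithfully on ay where ay is nonzero: so a = 0
    there, hence ay = 0. The same argument for y shows that a = 0 where y is
    nonzero, and there ann(a) = aA is both the unit and the zero ideal. *)
Lemma locally_simple_nilpart0 (a e : A) : locally_simple ->
  e * e = e -> e * (a * a) = 0 ->
  (forall r, e * (a * r) = 0 -> exists c, e * r = a * c) ->
  forall y : E, e *: y = 0.
Proof.
move=> Esimple ee ea ann y.
have [h [hh hy hann _]] := Esimple y.
have [k [_ ky kann _]] := Esimple ((e * a) *: y).
have eay : (e * a) *: y = 0.
  rewrite -ky scalerA mulrCA kann ?mulr0 ?scale0r //.
  by rewrite scalerA mulrCA ea scale0r.
have hea := hann _ eay.
have [|c cE] := ann h; first by rewrite -hea; ring.
have eh : e * h = 0.
  transitivity (e * h * (e * h)).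
    by transitivity (e * e * (h * h)); [rewrite ee hh | ring].
  by rewrite {1}cE; transitivity (h * (e * a) * c); [ring | rewrite hea mul0r].
by rewrite -hy scalerA eh scale0r.
Qed.

(** The three pieces of a are refined using the idempotent h of x on the piece
    where a = 0, that is, of e0 x. On the third piece of a the module E
    vanishes; so (a, x) is nilpotent with the right annihilator both there and
    on e0 h, and it vanishes on e0 (1 - h). *)
Lemma trivext_tripartite :
  (forall a : A, tripartite a) -> locally_simple ->
  forall x : trivext E, tripartite x.
Proof.
move=> Atri Esimple [a x].
have [e0 e1 e2 u e_orth e0a e1E e2a ann] := Atri a.
have [e00 e11 e22] := orthogonal_idem e_orth.
have [e_sum e01 e02 e12] := e_orth.
have e2E (y : E) : e2 *: y = 0.
  exact: (locally_simple_nilpart0 Esimple e22 e2a ann).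
have [h [hh hx hann hgen]] := Esimple (e0 *: x).
have hE (e e' : A) :
    ((e, 0) : trivext E) * ((e', 0) : trivext E) = (e * e', 0) :> trivext E.
  by rewrite trivext_mulE /= !scaler0 addr0.
apply: (@Tripartite (trivext E : comNzRingType) _
  (e0 * (1 - h), 0) (e1, 0) (e2 + e0 * h, 0)
  (e1 * u, - ((u * (e1 * u)) *: x))).
- split; rewrite ?hE.
  + rewrite !trivext_addE /= !addr0; congr pair.
    by transitivity (e0 + e1 + e2); [ring | exact: e_sum].
  + by congr pair; transitivity (e0 * e1 * (1 - h)); [ring | rewrite e01 mul0r].
  + congr pair; transitivity (e0 * e2 * (1 - h) + e0 * e0 * (h - h * h)).
      by ring.
    by rewrite e02 hh subrr mulr0 mul0r addr0.
  + congr pair; transitivity (e1 * e2 + e0 * e1 * h); first by ring.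
    by rewrite e12 e01 mul0r addr0.
- rewrite trivext_mulE /= scaler0 addr0; congr pair.
    by rewrite mulrAC e0a mul0r.
  by rewrite mulrC -scalerA scalerBl scale1r hx subrr.
- rewrite trivext_mulE /= scalerN scalerA; congr pair.
    by transitivity (e1 * (a * u)); [rewrite -e1E e11 | ring].
  rewrite addrC -scalerBl [X in X *: _](_ : _ = 0) ?scale0r //.
  transitivity (e1 * u * (1 - a * u)); first by ring.
  by rewrite -e1E mulrAC mulrBr mulr1 e11 subrr mul0r.
- rewrite !trivext_mulE /= scaler0 addr0; congr pair.
    transitivity (e2 * (a * a) + e0 * a * (h * a)); first by ring.
    by rewrite e2a e0a mul0r addr0.
  rewrite scalerDl e2E add0r -scalerDr !scalerA.
  by have -> : e0 * h * a = 0; [rewrite mulrAC e0a mul0r | rewrite scale0r].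
- move=> [r y]; rewrite !trivext_mulE /= scaler0 addr0 => H.
  have /= H1 := trivext_fst H; have /= H2 := trivext_snd H; clear H.
  have [|c cE] := ann r.
    transitivity (e2 * e2 * (a * r)); first by rewrite e22.
    transitivity (e2 * ((e2 + e0 * h) * (a * r)) - (e0 * a) * (e2 * h * r)).
      by ring.
    by rewrite H1 e0a; ring.
  have hr : h * r = 0.
    apply: hann; rewrite -hx; move: H2; rewrite scalerDl e2E add0r.
    rewrite scalerDr !scalerA mulrAC e0a mul0r scale0r add0r => <-.
    by congr (_ *: _); ring.
  have [d dE] := hgen y.
  exists (e2 * c + e0 * d, 0); rewrite trivext_mulE /= !scaler0 !addr0 add0r.
  congr pair.
    transitivity (e2 * r + e0 * (h * r)); first by ring.
    transitivity (e2 * (a * c) + e0 * a * d); last by ring.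
    by rewrite hr e0a -cE mulrA e22; ring.
  rewrite !scalerDl -(scalerA e2) !e2E !add0r -scalerA dE !scalerA.
  by congr (_ *: _); rewrite -{3}e00; ring.
Qed.

End TrivialExtensionCriterion.

(** * Localizations *)

(** A maximal ideal, by Zorn's lemma. The empty set is admitted among the
    candidates, as the union of the empty chain. *)
Lemma prime_ideal_containing (A : comNzRingType) (I : A -> Prop) :
  I 0 -> (forall r x y, I x -> I y -> I (r * x + y)) -> ~ I 1 ->
  exists P : prime_idealr A, forall x, I x -> x \in (P : pred A).
Proof.
move=> I0 Ilin I1.
pose good (X : set A) := [/\ forall r x y, X x -> X y -> X (r * x + y), ~ X 1
  & forall x y, X x -> I y -> X y].
have [F Fgood Ftot|J [[Jlin J1 JI] Jmax]] := @Zorn_bigcup A good.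
  split=> [r x y [X FX Xx] [Y FY Yy]|[X FX]|x y [X FX Xx] Iy].
  - have [Xlin _ _] := Fgood _ FX; have [Ylin _ _] := Fgood _ FY.
    have [XY|YX] := Ftot _ _ FX FY.
      by exists Y => //; apply: Ylin => //; apply: XY.
    by exists X => //; apply: Xlin => //; apply: YX.
  - by have [_ + _] := Fgood _ FX.
  - by have [_ _ /(_ x y Xx Iy)] := Fgood _ FX; exists X.
have gI : good I by split.
have J0 : J 0.
  apply: contrapT => nJ0.
  have Jempty x : ~ J x by move=> Jx; apply: nJ0; apply: JI Jx I0.
  by apply: (Jmax I) => //; split=> [x /Jempty//|/(_ _ I0)/nJ0[]].
have IJ x : I x -> J x by move=> Ix; apply: JI J0 Ix.
have Jmul r x : J x -> J (r * x) by move=> Jx; rewrite -[r * x]addr0; apply: Jlin.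
have Jadd x y : J x -> J y -> J (x + y).
  by move=> Jx Jy; rewrite -[x]mul1r; apply: Jlin.
have Jcomax x : ~ J x -> exists j r, J j /\ 1 = j + r * x.
  move=> nJx; apply: contrapT => no.
  pose K : set A := fun z => exists j r, J j /\ z = j + r * x.
  apply: (Jmax K); last split.
  - split=> [y Jy|KJ]; first by exists y, 0; rewrite mul0r addr0.
    by apply: nJx; apply: KJ; exists 0, 1; rewrite add0r mul1r.
  - move=> s _ _ [j [r [Jj ->]]] [k [t [Jk ->]]]; exists (s * j + k), (s * r + t).
    by split; [apply: Jlin | ring].
  - exact: no.
  - move=> _ y _ Iy; exists y, 0; split; first exact: IJ.
    by rewrite mul0r addr0.
pose S : A -> bool := fun x => `[< J x >].
have Sideal : idealr_closed S.
  split; first exact/asboolP; first by apply/negP => /asboolP.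
  by move=> r x y /asboolP Jx /asboolP Jy; apply/asboolP; apply: Jlin.
have Sprime : prime_idealr_closed S.
  move=> x y /asboolP Jxy; apply/orP.
  have [Jx|/Jcomax[j [r [Jj rE]]]] := EM (J x); first by left; apply/asboolP.
  right; apply/asboolP; rewrite -[y]mul1r rE mulrDl mulrC -mulrA.
  by apply: Jadd; apply: Jmul.
pose SI := isIdealr.Build A S Sideal.
pose SP := isPrimeIdealrClosed.Build A S Sprime.
pose P : prime_idealr A := HB.pack_for (prime_idealr A) S SI SP.
by exists P => x Ix; apply/asboolP; exact: IJ.
Qed.

Section Localization.
Variables (A : comNzRingType) (E : lmodType A).

Lemma in_Supp_notann (P : prime_idealr A) (x : E) :
  (forall s, s *: x = 0 -> s \in (P : pred A)) -> in_Supp P E.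
Proof.
move=> xann; exists (locfrac x (denom1 P)); apply/locfrac_eq0P => -[u /xann].
by rewrite (negPf (den_notin u)).
Qed.

Lemma locfrac_scale (P : prime_idealr A) (r : A) (s : denom P)
    (x : E) (t : denom P) :
  (locfrac (r : A^o) s : locring P) *: (locfrac x t : locmod P E)
    = locfrac (r *: x) (denomM s t).
Proof. exact: loc_scaleE. Qed.

End Localization.

Section Conditions.
Variables (A : comNzRingType) (E : lmodType A).
Hypothesis Atri : forall a : A, tripartite a.

Section LocallySimple.
Hypothesis Esimple : locally_simple E.

(** The idempotent h of x lies outside P: otherwise 1 - h lies outside P and
    kills x. *)
Lemma locally_simple_denom (P : prime_idealr A) (x : E) (s : denom P) :
  locfrac x s != 0 ->
  exists h : denom P, (forall r, r *: x = 0 -> den h * r = 0) /\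
    forall y, exists c, den h *: y = c *: x.
Proof.
move=> xs; have [h [hh hx hann hgen]] := Esimple x.
have hP : h \notin (P : pred A).
  apply/negP => hP; case/locfrac_eq0P: xs.
  have hP' : 1 - h \notin (P : pred A).
    apply/negP => h'P; have := idealr1 P.
    by rewrite -(subrK h 1) rpredD.
  by exists (Denom hP'); rewrite /= scalerBl scale1r hx subrr.
by exists (Denom hP).
Qed.

(** At P, exactly one piece of a survives. It is not the piece where a = 0, as
    a/t is nonzero, nor the third one, which kills E; so a is a unit there. *)
Lemma locally_simple_field (P : prime_idealr A) :
  in_Supp P E -> is_field (locring P).
Proof.
case; elim/locfracW=> x s /locally_simple_denom[h [hann _]].
elim/locfracW=> a t at0.
have [e0 e1 e2 u e_orth e0a e1E e2a ann] := Atri a.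
have [e00 e11 e22] := orthogonal_idem e_orth.
have [e_sum e01 e02 e12] := e_orth.
have e2P : e2 \in (P : pred A).
  apply: contraT => e2P; case/negP: (den_notin (denomM (Denom e2P) h)) => /=.
  have e2x := locally_simple_nilpart0 Esimple e22 e2a ann x.
  by rewrite mulrC hann ?idealr0.
have e0P : e0 \in (P : pred A).
  by apply: contraT => e0P; case/locfrac_eq0P: at0; exists (Denom e0P).
have e1P : e1 \notin (P : pred A).
  apply/negP => e1P; have := idealr1 P.
  by rewrite -e_sum !rpredD.
exists (locfrac (den t * u : A^o) (Denom e1P)).
transitivity (locfrac (a * (den t * u) : A^o) (denomM t (Denom e1P))).
  exact: locfrac_scale.
apply/eqP/locfrac_eqP; exists (denom1 P) => /=.
by rewrite /GRing.scale /= e1E; ring.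
Qed.

Lemma locally_simple_simple (P : prime_idealr A) : in_Supp P E ->
  simple_module (locmod P E : lmodType (locring P)).
Proof.
move=> suppE; split=> // S Sclosed.
have SZ := (GRing.subsemimod_closedZ (GRing.submod_closed_semi Sclosed)).
have [S0|nS0] := EM (forall x, x \in S -> x = 0); [by left | right].
have {nS0}[y [yS y0]] : exists y : locmod P E, y \in S /\ y != 0.
  apply: contrapT => no; apply: nS0 => y yS; apply: contrapT => y0.
  by apply: no; exists y; split=> //; apply/eqP.
elim/locfracW: y yS y0 => x s xS /locally_simple_denom[h [_ hgen]].
elim/locfracW=> y t; have [c cE] := hgen y.
have -> : locfrac y t =
    (locfrac (c * den s : A^o) (denomM h t) : locring P) *: locfrac x s.
  rewrite locfrac_scale; apply/eqP/locfrac_eqP; exists (denom1 P) => /=.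
  transitivity ((den t * den s) *: (den h *: y)); last rewrite cE.
    by rewrite scalerA; congr (_ *: _); ring.
  by rewrite !scalerA; congr (_ *: _); ring.
exact: SZ.
Qed.

Lemma locally_simple_FP_injective : FP_injective E.
Proof.
apply: divisible_FP_injective => // a z zann.
have [e0 e1 e2 u e_orth e0a e1E e2a ann] := Atri a.
have [e00 e11 e22] := orthogonal_idem e_orth.
have [e_sum e01 e02 e12] := e_orth.
exists (u *: z); rewrite scalerA -e1E -[LHS]scale1r -e_sum !scalerDl.
rewrite (locally_simple_nilpart0 Esimple e22 e2a ann) addr0.
by rewrite (zann e0) ?add0r // mulrC.
Qed.

(** For x with idempotent h and any y, the element x + (1 - h)y generates the
    same submodule as x and y: the component h recovers x, and hy is a multiple
    of x. *)
Lemma locally_simple_cyclic n (y : 'I_n -> E) :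
  exists x : E,
    (exists c, x = \sum_i c i *: y i) /\ forall i, exists c, y i = c *: x.
Proof.
elim: n y => [|n IH] y.
  by exists 0; split=> [|[]//]; exists (fun=> 0); rewrite big_ord0.
have [x [[c xE] cy]] := IH (fun i => y (lift ord0 i)).
have [h [hh hx _ hgen]] := Esimple x; have [k kE] := hgen (y ord0).
pose z := x + (1 - h) *: y ord0.
have hz : h *: z = x.
  by rewrite scalerDr hx scalerA mulrBr mulr1 hh subrr scale0r addr0.
exists z; split.
  exists (fun i => if unlift ord0 i is Some j then c j else 1 - h).
  rewrite big_ord_recl unlift_none /z [LHS]addrC xE; congr (_ + _).
  by apply: eq_bigr => i _; rewrite liftK.
move=> i; case: (unliftP ord0 i) => [j ->|->].
  by have [d ->] := cy j; exists (d * h); rewrite -scalerA hz.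
exists (k * h + (1 - h)); rewrite scalerDl -scalerA hz -kE scalerBl scale1r hz.
by rewrite /z [x + _]addrC addrK scalerBl scale1r addrC subrK.
Qed.

(** A finitely generated submodule is Ax, and ann(x) = (1 - h)A, so that a single
    relation presents it. *)
Lemma locally_simple_coherent : coherent_module E.
Proof.
move=> S N [n [g gonto]].
have [x [[c xE] cy]] := locally_simple_cyclic (fun i => \val (g (delta_mx 0 i))).
have [h [hh hx hann _]] := Esimple x.
pose x' := \sum_i c i *: g (delta_mx 0 i).
have x'E : \val x' = x.
  by rewrite xE linear_sum; apply: eq_bigr => i _; rewrite linearZ.
have [|f fE] := @linear_bundle A 'rV[A]_1 'rV[A]_1 (fun v => (1 - h) *: v).
  by move=> a u v; rewrite scalerDr !scalerA mulrC.
have [|p pE] := @linear_bundle A 'rV[A]_1 N (fun v => v 0 0 *: x').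
  by move=> a u v; rewrite !mxE scalerDl scalerA.
exists 1%N, 1%N, f, p; split=> [v|y].
  rewrite pE; split=> [vx|[w <-]].
    have /hann hv : v 0 0 *: x = 0 by rewrite -x'E -linearZ vx linear0.
    exists v; rewrite fE; apply/rowP => i.
    by rewrite mxE ord1 mulrBl mul1r hv subr0.
  apply: val_inj; rewrite linearZ linear0 /= x'E fE mxE mulrC -scalerA.
  by rewrite scalerBl scale1r hx subrr scaler0.
have /choice[d dE] i := cy i.
have [v <-] := gonto y; exists (const_mx (\sum_i v 0 i * d i)).
rewrite pE mxE; apply: val_inj; rewrite linearZ /= x'E.
rewrite (linear_rowE g) linear_sum scaler_suml; apply: eq_bigr => i _.
by rewrite linearZ /= dE scalerA.
Qed.

End LocallySimple.
End Conditions.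

(** * From localizations back to the module *)

Section CyclicSubmodule.
Variables (A : comNzRingType) (E : lmodType A) (x : E).

Definition multiples : {pred E} := fun y => `[< exists c, y = c *: x >].

Lemma multiples_closed : GRing.submod_closed multiples.
Proof.
split=> [|r y z /asboolP[c ->] /asboolP[d ->]]; apply/asboolP.
  by exists 0; rewrite scale0r.
by exists (r * c + d); rewrite scalerDl scalerA.
Qed.

HB.instance Definition _ :=
  GRing.isSubmodClosed.Build A E multiples multiples_closed.

Record cyclic_submodule :=
  CyclicSubmodule { cyclic_val : E; cyclic_valP : cyclic_val \in multiples }.

HB.instance Definition _ := [isSub for cyclic_val].
HB.instance Definition _ := [Choice of cyclic_submodule by <:].
HB.instance Definition _ := [SubChoice_isSubLmodule of cyclic_submodule by <:].

(** The kernel of one surjection from a finite free module onto Ax is finitely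
    generated, hence that of any other is. Explicitly, if c0 in A^n lifts x and
    [be] maps each v in A^n to a scalar with g(v) = be(v) x, then r x = 0 makes
    r c0 a relation, and r = r (1 - be(c0)) + be(r c0). *)
Lemma coherent_annihilator_fg : coherent_module E ->
  exists m (w : 'I_m -> A),
    forall r, r *: x = 0 <-> exists c : 'I_m -> A, r = \sum_i c i * w i.
Proof.
move=> Ecoh.
have xS : x \in multiples by apply/asboolP; exists 1; rewrite scale1r.
pose X : cyclic_submodule := CyclicSubmodule xS.
have [|m [n [f [g [fg gonto]]]]] :=
    Ecoh _ (cyclic_submodule : subLmodType multiples).
  have [|p pE] := @linear_bundle A 'rV[A]_1 cyclic_submodule (fun v => v 0 0 *: X).
    by move=> a u v; rewrite !mxE scalerDl scalerA.
  exists 1%N, p => -[y yS]; have /asboolP[c yE] := yS.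
  by exists (const_mx c); rewrite pE mxE; apply: val_inj; rewrite linearZ /= yE.
have [c0 c0E] := gonto X.
have /choice[b bE] i : exists c, \val (g (delta_mx 0 i)) = c *: x.
  by have /asboolP := cyclic_valP (g (delta_mx 0 i)).
have [be beE] := @linear_on_basis A A^o n b.
have gbe v : \val (g v) = (be v : A) *: x.
  rewrite (linear_rowE g) linear_sum beE scaler_suml.
  by apply: eq_bigr => i _; rewrite linearZ /= bE scalerA.
pose w (i : 'I_m.+1) : A :=
  if unlift ord0 i is Some j then be (f (delta_mx 0 j)) else 1 - be c0.
have gf v : g (f v) = 0 by apply/fg; exists v.
have wx i : w i *: x = 0.
  rewrite /w; case: unlift => [j|].
    by rewrite -gbe gf linear0.
  by rewrite scalerBl scale1r -gbe c0E subrr.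
exists m.+1, w => r; split=> [rx|[c ->]]; last first.
  by rewrite scaler_suml big1 // => i _; rewrite -scalerA wx scaler0.
have /fg[t tE] : g (r *: c0) = 0.
  by rewrite linearZ /= c0E; apply: val_inj; rewrite linearZ linear0; exact: rx.
exists (fun i => if unlift ord0 i is Some j then t 0 j else r).
rewrite big_ord_recl /w unlift_none.
have -> : \sum_(i < m)
      (if unlift ord0 (lift ord0 i) is Some j then t 0 j else r) *
      (if unlift ord0 (lift ord0 i) is Some j then be (f (delta_mx 0 j))
       else 1 - be c0)
    = be (r *: c0).
  rewrite -tE (linear_rowE f) linear_sum; apply: eq_bigr => i _.
  by rewrite liftK linearZ.
by rewrite linearZ mulrBr mulr1; apply/esym; exact: (subrK (r * (be c0 : A)) r).
Qed.

End CyclicSubmodule.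

Section Converse.
Variables (A : comNzRingType) (E : lmodType A).
Hypothesis Atri : forall a : A, tripartite a.
Hypothesis Afield : forall P : prime_idealr A, in_Supp P E -> is_field (locring P).

(** If ey were nonzero, choose a prime P containing its annihilator. Then e is
    outside P and E_P is nonzero, so A_P is a field, in which a, nilpotent on the
    piece e, becomes 0. Then u a = 0 for some u outside P, so that eu is in aA,
    inside P. *)
Lemma field_nilpart0 (a e : A) :
  e * e = e -> e * (a * a) = 0 ->
  (forall r, e * (a * r) = 0 -> exists c, e * r = a * c) ->
  forall y : E, e *: y = 0.
Proof.
move=> ee ea ann y; apply: contrapT => ey.
have [|r s z /= rz sz||P annP] := @prime_ideal_containing A
  (fun r => r *: (e *: y) = 0).
- by rewrite scale0r.
- by rewrite scalerDl -scalerA rz sz scaler0 addr0.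
- by rewrite scale1r.
have eP : e \notin (P : pred A).
  apply/negP => eP; have := idealr1 P; rewrite -(subrK e 1) rpredD //.
  by apply: annP; rewrite scalerA mulrBl mul1r ee subrr scale0r.
have aP : a \in (P : pred A).
  have: e * (a * a) \in (P : pred A) by rewrite ea idealr0.
  by rewrite !prime_idealrM (negPf eP) orbb.
have [a0|a1] := eqVneq (locfrac (a : A^o) (denom1 P) : locring P) 0.
  have /locfrac_eq0P[u ua] : locfrac (a : A^o) (denom1 P) == 0 by apply/eqP.
  have [|c cE] := ann (den u).
    by rewrite [a * _]mulrC (_ : den u * a = 0) ?mulr0.
  have : e * den u \in (P : pred A) by rewrite cE mulrC idealMr.
  by rewrite prime_idealrM (negPf eP) (negPf (den_notin u)).
have [] := Afield (in_Supp_notann annP) a1.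
elim/locfracW => b s; rewrite [_ * _]locfrac_scale => /eqP/locfrac_eqP[u /= uE].
have {}uE : den u * 1 * (a * b) = den u * (1 * den s) * 1 := uE.
have : den u * den s \in (P : pred A).
  have -> : den u * den s = den u * b * a.
    by rewrite -[LHS]mulr1 -[den s in LHS]mul1r -uE; ring.
  exact: idealMr.
by rewrite prime_idealrM !(negPf (den_notin _)).
Qed.

Hypothesis Esimple : forall P : prime_idealr A, in_Supp P E ->
  simple_module (locmod P E : lmodType (locring P)).
Hypothesis Ecoh : coherent_module E.

(** Each generator w of ann(x) lies in the ideal of an idempotent of ann(x),
    namely e1 + e2: e1 is a multiple of w, and e2 kills E. Finitely many
    idempotents generate an ideal with an idempotent generator. *)
Lemma annihilator_idempotent (x : E) :
  exists k : A, [/\ k * k = k, k *: x = 0 & forall r, r *: x = 0 -> r * k = r].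
Proof.
have [m [w wE]] := coherent_annihilator_fg x Ecoh.
have wx i : w i *: x = 0.
  apply/wE; exists (fun j => (j == i)%:R); rewrite (bigD1 i) //= eqxx mul1r.
  by rewrite big1 ?addr0 // => j /negPf->; rewrite mul0r.
suff [k [kk kx wk]] : exists k : A, [/\ k * k = k, k *: x = 0 &
    forall i, i \in enum 'I_m -> w i * k = w i].
  exists k; split=> // r /wE[c ->]; rewrite mulr_suml; apply: eq_bigr => i _.
  by rewrite -mulrA wk // mem_enum.
elim: (enum 'I_m) => [|i s [k [kk kx wk]]].
  by exists 0; split=> //; rewrite ?mulr0 ?scale0r.
have [e0 e1 e2 u e_orth e0a e1E e2a ann] := Atri (w i).
have [e00 e11 e22] := orthogonal_idem e_orth.
have [e_sum e01 e02 e12] := e_orth.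
have e0x : e0 *: x = x.
  have -> : e0 = 1 - u * w i - e2 by rewrite -e_sum e1E; ring.
  rewrite !scalerBl scale1r -scalerA wx (field_nilpart0 e22 e2a ann).
  by rewrite scaler0 !subr0.
(* 1 - e0 = e1 + e2 generates an ideal containing w i; joining it with the
   idempotent k of the other generators gives 1 - (1 - k) e0. *)
exists (1 - (1 - k) * e0); split.
- transitivity (1 - 2 * ((1 - k) * e0) + (1 - 2 * k + k * k) * (e0 * e0)).
    by ring.
  by rewrite kk e00; ring.
- by rewrite scalerBl scale1r -scalerA e0x scalerBl scale1r kx subr0 subrr.
- move=> j; rewrite inE => /predU1P[->|/wk wjk].
    by transitivity (w i - (1 - k) * (e0 * w i)); [ring | rewrite e0a; ring].
  by transitivity (w j - (w j - w j * k) * e0); [ring | rewrite wjk; ring].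
Qed.

(** If hy is not in Ax, choose a prime P containing all r with r h y in Ax.  It
    contains ann(x), so x is nonzero in the simple module E_P and generates
    it; hence some element outside P multiplies hy into Ax. *)
Lemma simple_localizations_locally_simple : locally_simple E.
Proof.
move=> x; have [k [kk kx kann]] := annihilator_idempotent x.
pose h := 1 - k.
have hh : h * h = h.
  by rewrite /h; transitivity (1 - 2 * k + k * k); [ring | rewrite kk; ring].
have hx : h *: x = x by rewrite scalerBl scale1r kx subr0.
have hann r : r *: x = 0 -> h * r = 0.
  by move=> /kann rk; rewrite mulrBl mul1r mulrC rk subrr.
clearbody h; exists h; split=> // y; apply: contrapT => nhy.
have [|r s t [c cE] [d dE]||P IP] := @prime_ideal_containing A
  (fun r => exists c, r *: (h *: y) = c *: x).
- by exists 0; rewrite !scale0r.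
- by exists (r * c + d); rewrite !scalerDl -!scalerA cE dE.
- by rewrite scale1r.
have xann s : s *: x = 0 -> s \in (P : pred A).
  by move=> /hann hs; apply: IP; exists 0; rewrite scalerA mulrC hs !scale0r.
have [_ simpleP] := Esimple (in_Supp_notann xann).
pose S : {pred locmod P E} := fun z =>
  `[< exists r : locring P, z = r *: locfrac x (denom1 P) >].
have [|S0|ST] := simpleP S.
- split=> [|r y1 y2 /asboolP[c ->] /asboolP[d ->]]; apply/asboolP.
    by exists 0; rewrite scale0r.
  by exists (r * c + d); rewrite scalerDl scalerA.
- have /eqP/locfrac_eq0P[u /xann] : locfrac x (denom1 P) = 0.
    by apply: S0; apply/asboolP; exists 1; rewrite scale1r.
  by rewrite (negPf (den_notin u)).
have /asboolP[r] := ST (locfrac y (denom1 P)).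
elim/locfracW: r => c s; rewrite locfrac_scale => /eqP/locfrac_eqP[u /= uE].
have {}uE : (den u * den s) *: y = (den u * c) *: x.
  by move: uE; rewrite !mulr1 scalerA.
have : den u * den s \in (P : pred A).
  apply: IP; exists (den u * c).
  by rewrite scalerA mulrC -scalerA uE scalerA mulrC -scalerA hx.
by rewrite prime_idealrM !(negPf (den_notin _)).
Qed.

End Converse.

Theorem theorem3p1 (A : comNzRingType) (E : lmodType A)
    (E_neq0 : exists e : E, e != 0) :
  semiregular1 (trivext E) <->
  [/\ semiregular1 A,
      forall P : prime_idealr A, in_Supp P E -> is_field (locring P),
      forall P : prime_idealr A, in_Supp P E ->
        simple_module (locmod P E : lmodType (locring P)) &
      FP_injective E /\ coherent_module E].
Proof.
split=> [/semiregular1_tripartite Etri|].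
  have Atri := trivext_tripartite_base Etri.
  have Eloc := trivext_tripartite_module Etri.
  split; first exact: tripartite_semiregular1.
  - exact: locally_simple_field.
  - exact: locally_simple_simple.
  - by split; [exact: locally_simple_FP_injective | exact: locally_simple_coherent].
case=> /semiregular1_tripartite Atri Afield Esimple [_ Ecoh].
apply: tripartite_semiregular1; apply: trivext_tripartite => //.
exact: simple_localizations_locally_simple.
Qed.
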